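(* Let $n\ge2$, let $\mathcal A$ be a first-order complex-elliptic operator from $V$ to $W$ on $\mathbb R^n$, let $\Omega\subset\mathbb R^n$ be open, and let $u\in BV^{\mathcal A}(\Omega)$. For balls $B_r(x)\subset\Omega$ let $p_{x,r}u$ be the $V$-valued polynomials of degree at most $\ell-1$ in the Poincaré inequality $\|u-p_{x,r}u\|_{L^{n/(n-1)}(B_r(x))}\le c\,|\mathcal A u|(B_r(x))$ (see context), and write $$p_{x,r}u(y)=\sum_{\beta\in\mathbb N_0^n,\ |\beta|\le\ell-1}a_\beta(x,r)\,(y-x)^\beta,\qquad a_\beta(x,r)\in V .$$ Then there is a constant $C$ depending only on $n$ and $\mathcal A$ such that, for every $x\in\Omega$, $$\limsup_{r\downarrow0}\ r^{|\beta|}\,|a_\beta(x,r)|\le C\,\theta^{*(n-1)}(\mathcal A u,x)\qquad\text{for all }1\le|\beta|\le\ell-1,$$ and $$\limsup_{r\downarrow0}\ \inf_{z\in V}\left(\frac1{\mathcal L^n(B_r(x))}\int_{B_r(x)}|u(y)-z|^{\frac n{n-1}}\,dy\right)^{\frac{n-1}{n}}\le C\,\theta^{*(n-1)}(\mathcal A u,x).$$ In particular, the limits (as $r\downarrow 0$) of the quantities in both displays exist and equal zero at every $x\in\Omega\setminus\Theta_u$.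
   Context: $V,W$ are finite-dimensional real inner product spaces. A first-order operator from $V$ to $W$ on $\mathbb R^n$ is a homogeneous linear constant-coefficient differential operator $\mathcal A u=\sum_{j=1}^n A_j\partial_j u$ with $A_j\in\mathrm{Lin}(V;W)$, acting on distributions; its symbol is $\mathbb A(\xi)=\sum_j\xi_jA_j$. It is complex-elliptic if $\mathbb A(\xi):\mathbb C\otimes V\to\mathbb C\otimes W$ is injective for every $\xi\in\mathbb C^n\setminus\{0\}$. $BV^{\mathcal A}(\Omega)$ is the space of $u\in L^1(\Omega;V)$ whose distributional $\mathcal A u$ is represented by a finite $W$-valued Radon measure on $\Omega$, with total variation measure $|\mathcal A u|$. Poincaré inequality (known, for first-order complex-elliptic $\mathcal A$): there exist a positive integer $\ell=\ell(\mathcal A)$ and a positive constant $c=c(n,\mathcal A)$ such that for every $u\in BV^{\mathcal A}(\Omega)$ and every ball $B_r(x)\subset\Omega$ there is a $V$-valued polynomial $p_{x,r}u$ of degree at most $\ell-1$ with $$\|u-p_{x,r}u\|_{L^{n/(n-1)}(B_r(x))}\le c\,|\mathcal A u|(B_r(x)).$$ Such $\ell$, $c$ and polynomials $p_{x,r}u$ are fixed. $\theta^{*(n-1)}(\mathcal A u,x)=\limsup_{r\downarrow0}\frac{|\mathcal A u|(B_r(x))}{r^{n-1}}\in[0,\infty]$, and $\Theta_u=\{x\in\Omega:\theta^{*(n-1)}(\mathcal A u,x)>0\}$. *)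

(* Defs.v *)
From HB Require Import structures.
From mathcomp Require Import all_boot all_order all_algebra.
From mathcomp Require Import sesquilinear complex.
From mathcomp Require Import all_classical all_reals all_analysis.
From mathcomp Require Import measurable_realfun ring.
Set Implicit Arguments. Unset Strict Implicit. Unset Printing Implicit Defensive.
Import Order.TTheory GRing.Theory Num.Theory numFieldNormedType.Exports.
Local Open Scope classical_set_scope. Local Open Scope ring_scope.

(* The norm that MathComp puts on row vectors is the sup norm; it induces the
   usual topology of R^n, but balls below are Euclidean. *)
Definition enorm (R : realType) (n : nat) (x : 'rV[R]_n) : R :=
  Num.sqrt (\sum_(i < n) x 0 i ^+ 2).

Definition eball (R : realType) (n : nat) (x : 'rV[R]_n) (r : R) : set 'rV[R]_n :=
  [set y | enorm (y - x) < r].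

Definition borelRn (R : realType) (n : nat) := g_sigma_algebraType (@open 'rV[R]_n).
HB.instance Definition _ R n := Measurable.on (borelRn R n).

Lemma measurable_borelRn d (T : measurableType d) (R : realType) (n : nat)
    (f : T -> borelRn R n) :
  (forall i, measurable_fun setT (fun t => f t 0 i : measurableTypeR R)) ->
  measurable_fun setT f.
Proof.
move=> mf; apply: measurability => // _ [A oA <-]; rewrite setTI.
pose B (p : 'rV[rat]_n * nat) : set 'rV[R]_n :=
  [set x | forall i, `|ratr (p.1 0 i) - x 0 i| < p.2.+1%:R^-1].
have mB p : measurable (f @^-1` B p).
  have -> : f @^-1` B p = \bigcap_(i : 'I_n)
      ((fun t => f t 0 i : measurableTypeR R) @^-1`
         [set y | `|ratr (p.1 0 i) - y| < p.2.+1%:R^-1]).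
    by apply/seteqP; split => t /= h i => [_|]; exact: h.
  apply: fin_bigcap_measurable => [|i _]; first exact: finite_finset.
  rewrite -[X in measurable X]setTI; apply: mf => //.
  have -> : [set y : R | `|ratr (p.1 0 i) - y| < p.2.+1%:R^-1] =
      ball (ratr (p.1 0 i) : R) p.2.+1%:R^-1 by [].
  apply: open_measurable; exact: ball_open.
have -> : f @^-1` A = \bigcup_p (if `[< B p `<=` A >] then f @^-1` B p else set0).
  apply/seteqP; split => [t At|t [p _]] /=; last first.
    by case: asboolP => // BA /BA.
  have /nbhs_ballP[e /= e0 eA] : nbhs (f t : 'rV[R]_n) A.
    exact: open_nbhs_nbhs.
  have [k ke] : exists k : nat, k.+1%:R^-1 < e / 2.
    have := @near_infty_natSinv_lt R (PosNum (divr_gt0 e0 (ltr0Sn _ 1))).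
    by move=> [k _ /(_ k (leqnn k))] ?; exists k.
  have qP i : exists q : rat, `|ratr q - f t 0 i| < k.+1%:R^-1.
    have [|q] := @rat_in_itvoo R (f t 0 i - k.+1%:R^-1) (f t 0 i).
      by rewrite ltrBlDr ltrDl invr_gt0.
    rewrite in_itv /= => /andP[q1 q2]; exists q.
    by rewrite distrC ger0_norm ?subr_ge0 ?ltW// ltrBlDr -ltrBlDl.
  exists (\row_i sval (cid (qP i)), k) => //.
  case: asboolP => [_ i|]; first by rewrite mxE; case: cid.
  case=> x Bx; apply: eA; split => // i0 j; rewrite ord1 /ball/=.
  have := Bx j; rewrite mxE /=; case: cid => q /= qt qx.
  rewrite (le_lt_trans (ler_distD (ratr q) _ _))// distrC.
  by rewrite [ltRHS]splitr ltrD// (lt_trans _ ke).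
apply: countable_bigcupT_measurable => // p.
by case: asboolP.
Qed.

Lemma measurable_coord_rV (R : realType) (n : nat) (i : 'I_n) :
  measurable_fun setT (fun x : borelRn R n => x 0 i : measurableTypeR R).
Proof.
apply: (measurability _ (RGenOpens.measurableE R)) => _ [_ [a [b ->]] <-].
rewrite setTI; apply: sub_sigma_algebra.
by apply: open_comp => [x _|]; [exact: coord_continuous|exact: interval_open].
Qed.

Definition rV_cons (R : realType) (n : nat)
  (p : measurableTypeR R * borelRn R n) : borelRn R n.+1 :=
  row_mx (const_mx p.1 : 'rV_1) p.2.

Lemma measurable_rV_cons (R : realType) (n : nat) :
  measurable_fun setT (@rV_cons R n).
Proof.
apply: measurable_borelRn => i.
case: (@split_ordP 1 n i) => j ->.
  rewrite (_ : (fun _ => _) = fst); last first.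
    by apply/funext => p; apply: etrans (row_mxEl _ _ _ _) _; rewrite mxE.
  exact: measurable_fst.
rewrite (_ : (fun _ => _) = (fun x : borelRn R n => x 0 j) \o snd); last first.
  by apply/funext => p; exact: row_mxEr.
by apply: measurableT_comp => //; exact: measurable_coord_rV.
Qed.

HB.instance Definition _ (R : realType) (n : nat) :=
  isMeasurableFun.Build _ _ _ _ (@rV_cons R n) (@measurable_rV_cons R n).

Section lebesgue_cons.
Context (R : realType) (n : nat).
Variable m : {sigma_finite_measure set (borelRn R n) -> \bar R}.

Definition lebesgue_cons : set (borelRn R n.+1) -> \bar R :=
  pushforward (lebesgue_measure \x m)%E (@rV_cons R n).

Let lebesgue_cons0 : lebesgue_cons set0 = 0%E.
Proof. exact: measure0. Qed.

Let lebesgue_cons_ge0 A : (0 <= lebesgue_cons A)%E.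
Proof. exact: measure_ge0. Qed.

Let lebesgue_cons_sigma_additive : semi_sigma_additive lebesgue_cons.
Proof. exact: measure_semi_sigma_additive. Qed.

HB.instance Definition _ := isMeasure.Build _ _ _ lebesgue_cons
  lebesgue_cons0 lebesgue_cons_ge0 lebesgue_cons_sigma_additive.

Let rV_uncons (x : borelRn R n.+1) : measurableTypeR R * borelRn R n :=
  (x 0 0, rsubmx (x : 'rV_(1 + n))).

Let measurable_rV_uncons : measurable_fun setT rV_uncons.
Proof.
apply/measurable_fun_pairP; split; first exact: measurable_coord_rV.
apply: measurable_borelRn => i /=.
rewrite (_ : (fun _ => _) = fun x : borelRn R n.+1 => x 0 (rshift 1 i)).
  exact: measurable_coord_rV.
by apply/funext => x; rewrite mxE.
Qed.

Let rV_consK : cancel (@rV_cons R n) rV_uncons.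
Proof.
case=> t v; rewrite /rV_uncons /rV_cons /= row_mxKr; congr (_, _).
have -> : 0 = @lshift 1 n 0 :> 'I_(1 + n) by apply/val_inj.
by apply: etrans (row_mxEl _ _ _ _) _; rewrite mxE.
Qed.

Let lebesgue_cons_sigma_finite : sigma_finite setT lebesgue_cons.
Proof.
have /sigma_finiteP[F [TF ndF Foo]] := sigma_finiteT (@lebesgue_measure R).
have /sigma_finiteP[G [TG ndG Goo]] := sigma_finiteT m.
exists (fun i => rV_uncons @^-1` (F i `*` G i)).
  apply/seteqP; split => // x _.
  have [i _ Fi] : (\bigcup_i F i) (rV_uncons x).1 by rewrite -TF.
  have [j _ Gj] : (\bigcup_j G j) (rV_uncons x).2 by rewrite -TG.
  exists (maxn i j) => //; split.
  - by move: Fi; exact/subsetPset/ndF/leq_maxl.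
  - by move: Gj; exact/subsetPset/ndG/leq_maxr.
move=> i; have [mF Fi] := Foo i; have [mG Gi] := Goo i; split.
  rewrite -[X in measurable X]setTI; apply: measurable_rV_uncons => //.
  exact: measurableX.
rewrite /lebesgue_cons /pushforward (_ : _ @^-1` _ = F i `*` G i).
  by rewrite product_measure1E// lte_mul_pinfty// ge0_fin_numE.
by apply/funext => x; rewrite -[in RHS](rV_consK x).
Qed.

HB.instance Definition _ := Measure_isSigmaFinite.Build _ _ _ lebesgue_cons
  lebesgue_cons_sigma_finite.

End lebesgue_cons.

(* Lebesgue measure on the Borel sets of R^n, as the n-fold product of the
   one-dimensional one. *)
Fixpoint lebesgueRn (R : realType) (n : nat) :
    {sigma_finite_measure set (borelRn R n) -> \bar R} :=
  match n with
  | 0 => \d_(0 : borelRn R 0)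
  | n.+1 => lebesgue_cons (lebesgueRn R n)
  end.

Lemma lebesgueRn_box (R : realType) (n : nat)
    (A : 'I_n -> set (measurableTypeR R)) :
  (forall i, measurable (A i)) ->
  lebesgueRn R n [set x : 'rV_n | forall i, A i (x 0 i)] =
  (\prod_(i < n) lebesgue_measure (A i))%E.
Proof.
elim: n A => [A _|n IH A mA].
  rewrite big_ord0 /= diracE mem_set//= => i; by case: i.
rewrite big_ord_recl /= /lebesgue_cons /pushforward.
rewrite -IH; last by move=> i; exact: mA.
rewrite -product_measure1E//; first last.
  have -> : [set x : 'rV_n | forall i, A (lift ord0 i) (x 0 i)] =
      \bigcap_(i : 'I_n) ((fun x : borelRn R n => x 0 i) @^-1` A (lift ord0 i)).
    by apply/seteqP; split => x /= h i => [_|]; exact: h.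
  apply: fin_bigcap_measurable => [|i _]; first exact: finite_finset.
  by rewrite -[X in measurable X]setTI; exact: measurable_coord_rV.
congr (_ _); apply/seteqP; split => -[t v] /=.
  move=> h; split=> [|i].
    have := h ord0; rewrite (_ : ord0 = @lshift 1 n 0); last exact/val_inj.
    suff -> : rV_cons (t, v) 0 (@lshift 1 n 0) = t by [].
    by apply: etrans (row_mxEl _ _ _ _) _; rewrite mxE.
  have := h (lift ord0 i); rewrite (_ : lift ord0 i = @rshift 1 n i); last exact/val_inj.
  suff -> : rV_cons (t, v) 0 (@rshift 1 n i) = v 0 i by [].
  exact: row_mxEr.
move=> [At Av] i; case: (@split_ordP 1 n i) => j ->.
  suff -> : rV_cons (t, v) 0 (@lshift 1 n j) = t.
    by rewrite (_ : lshift n j = ord0)//; apply/val_inj; rewrite /= ord1.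
  by apply: etrans (row_mxEl _ _ _ _) _; rewrite mxE.
suff -> : rV_cons (t, v) 0 (@rshift 1 n j) = v 0 j.
  by have := Av j; rewrite (_ : lift ord0 j = @rshift 1 n j)//; exact/val_inj.
exact: row_mxEr.
Qed.

Section inner_product.
Context (R : realType) (V : lmodType R) (dot : {dot V for idfun}).

Definition ipnorm (v : V) : R := Num.sqrt (dot v v).

Lemma dot_ge0 v : 0 <= dot v v.
Proof.
have [->|/neq0_dnorm_gt0/ltW//] := eqVneq v 0.
by rewrite linear0l.
Qed.

Lemma dotC v w : dot v w = dot w v.
Proof. by have := hermitian_subproof v w : dot v w = _; rewrite expr0 mul1r. Qed.

Lemma cauchy_schwarz v w : `|dot v w| <= ipnorm v * ipnorm w.
Proof.
have [->|w0] := eqVneq w 0.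
  by rewrite linear0r normr0 mulr_ge0// sqrtr_ge0.
have ww : 0 < dot w w by exact: neq0_dnorm_gt0.
have := dot_ge0 (dot w w *: v - dot v w *: w).
rewrite linearBl !linearBr /= !linearZl_LR /= !linearZr_LR /= (dotC w v) => h.
rewrite /ipnorm -sqrtrM ?dot_ge0// -sqrtr_sqr ler_wsqrtr// -subr_ge0.
rewrite -(pmulr_rge0 _ ww); apply: le_trans h _.
rewrite le_eqVlt; apply/orP; left; apply/eqP. rewrite /GRing.scale /=; ring.
Qed.
End inner_product.

Section first_order_operator.
Context (R : realType) (n : nat) (V W : vectType R).
Implicit Types (A : 'I_n -> 'Hom(V, W)).

Definition symbol A (xi : 'rV[R]_n) (v : V) : W := \sum_(j < n) xi 0 j *: A j v.

(* The pair (v, v') stands for the element v + i v' of the complexification. *)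
Definition symbolC A (xi : 'rV[R[i]]_n) (v : V * V) : W * W :=
  let a := map_mx (@complex.Re R) xi in
  let b := map_mx (@complex.Im R) xi in
  (symbol A a v.1 - symbol A b v.2, symbol A a v.2 + symbol A b v.1).

Definition complex_elliptic A :=
  forall xi : 'rV[R[i]]_n, xi != 0 -> injective (symbolC A xi).

End first_order_operator.

Section test_functions.
Context (R : realType) (n : nat).
Implicit Types (phi : 'rV[R]_n -> R).

Definition iter_partial (s : seq 'I_n) phi : 'rV[R]_n -> R :=
  foldr (fun j g x => 'D_('e_j) g x) phi s.

Definition smooth phi := forall s : seq 'I_n,
  continuous (iter_partial s phi) /\
  forall j x, derivable (iter_partial s phi) x 'e_j.

Definition test_function (Omega : set 'rV[R]_n) phi :=
  let supp := closure [set y | phi y != 0] in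
  [/\ smooth phi, compact supp & supp `<=` Omega].

End test_functions.

Section vector_measure.
Context (R : realType) (n : nat) (W : vectType R) (dW : {dot W for idfun}).

(* Finite W-valued Borel (hence Radon) measures; finiteness of the total
   variation is automatic since W is finite-dimensional. *)
Record vmeasure := VMeasure {
  vmeasure_fun :> set (borelRn R n) -> W ;
  vmeasure0 : vmeasure_fun set0 = 0 ;
  vmeasure_sigma_additive : forall F : (set (borelRn R n))^nat,
    (forall k, measurable (F k)) -> trivIset setT F ->
    ipnorm dW (vmeasure_fun (\bigcup_k F k) - \sum_(k < m) vmeasure_fun (F k))
      @[m --> \oo] --> (0 : R) }.

Definition vector_variation (mu : vmeasure) (E : set (borelRn R n)) : \bar R :=
  ereal_sup [set (\sum_(0 <= k <oo) (ipnorm dW (mu (F k)))%:E)%E | F in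
    [set F : (set (borelRn R n))^nat |
      [/\ forall k, measurable (F k), trivIset setT F & \bigcup_k F k = E]]].

Section component.
Variables (mu : vmeasure) (w : W).

Definition vcomponent (E : set (borelRn R n)) : \bar R := (dW (mu E) w)%:E.

Let vcomponent0 : vcomponent set0 = 0%E.
Proof. by rewrite /vcomponent vmeasure0 linear0l. Qed.

Let vcomponent_finite E : measurable E -> vcomponent E \is a fin_num.
Proof. by []. Qed.

Let vcomponent_sigma_additive : semi_sigma_additive vcomponent.
Proof.
move=> F mF tF _; apply/fine_cvgP; split.
  by apply: nearW => m; rewrite sumEFin.
rewrite /vcomponent; apply/cvgrPdist_le => e e0.
have /cvgrPdist_le/(_ (e / (ipnorm dW w + 1))) :=
  vmeasure_sigma_additive mu mF tF.
have w1 : 0 < ipnorm dW w + 1 by rewrite ltr_wpDl// sqrtr_ge0.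
move=> /(_ (divr_gt0 e0 w1)); apply: filterS => m.
rewrite sub0r normrN ger0_norm ?sqrtr_ge0// => h.
rewrite /= sumEFin /= big_mkord -linear_sumlz -linearBl.
apply: (le_trans (cauchy_schwarz _ _ _)).
rewrite (le_trans (ler_wpM2r (sqrtr_ge0 _) h))// mulrAC ler_pdivrMr//.
by rewrite ler_wpM2l// ?(ltW e0)// lerDl.
Qed.

HB.instance Definition _ := isCharge.Build _ _ _ vcomponent
  vcomponent0 vcomponent_finite vcomponent_sigma_additive.

End component.

End vector_measure.

(* The integral against a signed measure does not depend on the Hahn
   decomposition that is chosen. *)
Definition charge_integral d (T : measurableType d) (R : realType)
    (nu : {charge set T -> \bar R}) (D : set T) (f : T -> R) : \bar R :=
  let P := cid (Hahn_decomposition nu) in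
  let N := cid (svalP P) in
  (\int[jordan_pos (svalP N)]_(x in D) (f x)%:E -
   \int[jordan_neg (svalP N)]_(x in D) (f x)%:E)%E.

Section BV.
Context (R : realType) (n : nat) (V W : vectType R)
  (dV : {dot V for idfun}) (dW : {dot W for idfun}).
Implicit Types (A : 'I_n -> 'Hom(V, W)) (Omega : set 'rV[R]_n).
Implicit Types (u : 'rV[R]_n -> V) (Au : vmeasure n dW).

(* V is finite-dimensional, so measurability is measurability of all the
   scalar functions y |-> <u(y), v>. *)
Definition in_L1 Omega u :=
  (forall v, measurable_fun (Omega : set (borelRn R n)) (fun y => dV (u y) v)) /\
  (\int[lebesgueRn R n]_(y in Omega) (ipnorm dV (u y))%:E < +oo)%E.

(* int phi d<Au, w> = - int_Omega sum_j (d_j phi) <A_j u, w> for all test functions phi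
   and vectors w, i.e. sum_j A_j d_j u = Au in the sense of distributions.
   Finite measures on Omega are the restrictions to Borel subsets of Omega of
   finite measures on R^n; only these values of Au matter. *)
Definition represents A Omega u Au := forall phi, test_function Omega phi ->
  forall w : W,
    charge_integral (vcomponent Au w) Omega phi =
    (- \int[lebesgueRn R n]_(y in Omega)
        (\sum_(j < n) 'D_('e_j) phi y * dW (A j (u y)) w)%:E)%E.

Definition BV A Omega u Au := in_L1 Omega u /\ represents A Omega u Au.

Definition upper_density Au (x : 'rV[R]_n) : \bar R :=
  limf_esup (fun r : R => vector_variation Au (eball x r) * (r ^- n.-1)%:E)%E 0^'+.

Definition Theta Omega Au : set 'rV[R]_n :=
  [set x | Omega x /\ (0 < upper_density Au x)%E].

(* The exponent n/(n-1) is that of the Sobolev embedding of W^(1,1). *)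
Definition Lstar_norm (E : set (borelRn R n)) (f : 'rV[R]_n -> V) : \bar R :=
  ((\int[lebesgueRn R n]_(y in E) (ipnorm dV (f y) `^ (n%:R / n.-1%:R))%:E)
    `^ (n.-1%:R / n%:R))%E.

Definition mean_oscillation u (x : 'rV[R]_n) (r : R) : \bar R :=
  ereal_inf [set
    (((fine (lebesgueRn R n (eball x r)))^-1%:E *
      \int[lebesgueRn R n]_(y in eball x r)
        (ipnorm dV (u y - z) `^ (n%:R / n.-1%:R))%:E)
      `^ (n.-1%:R / n%:R))%E | z in [set: V]].

End BV.

(* Every multi-index beta with |beta| <= l - 1 has all its entries < l, so
   these multi-indices form a subset of the finite type mindex n l. *)
Definition mindex (n l : nat) := {ffun 'I_n -> 'I_l}.

Definition mdegree (n l : nat) (b : mindex n l) : nat := (\sum_(i < n) b i)%N.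

Definition monomial (R : realType) (n l : nat) (b : mindex n l) (y : 'rV[R]_n) : R :=
  \prod_(i < n) y 0 i ^+ b i.

(* Main.v *)
Require Import Defs.
From HB Require Import structures.
From mathcomp Require Import all_boot all_order all_algebra.
From mathcomp Require Import sesquilinear complex.
From mathcomp Require Import all_classical all_reals all_analysis.
From mathcomp Require Import measurable_realfun ring lra.
Set Implicit Arguments. Unset Strict Implicit. Unset Printing Implicit Defensive.
Import Order.TTheory GRing.Theory Num.Theory numFieldNormedType.Exports.
Local Open Scope classical_set_scope. Local Open Scope ring_scope.

(** Write D(r) = |Au|(B_r(x)) / r^(n-1). Since n / (n/(n-1)) = n-1, the
    Poincare inequality says that u differs from p_{x,r} u on B_r(x) by at most
    a multiple of D(r), in the sense of normalised L^(n/(n-1)) averages.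

    Comparison of two radii. If r/2 <= s <= r, both p_{x,r} u and p_{x,s} u are
    close to u on B_s(x), hence close to each other; as polynomials of bounded
    degree form a finite-dimensional space, their coefficients are close:
      s^|b| |a_b(x,r) - a_b(x,s)| <= C (D(r) + D(s))
    (coefficient_comparison). The equivalence of norms behind this step is made
    explicit: the coefficients are recovered from the values on a tensor grid
    by a tensored inverse Vandermonde matrix, and by perturbation also from the
    values at any points close enough to the grid (grid_stability). In each
    small cube around a grid point, a Chebyshev argument gives a point where
    both polynomials are close to u (common_small_point).

    Decay. Put g(r) = r^|b| |a_b(x,r)| with |b| >= 1. The comparison gives
      g(s) <= (s/r) g(r) + C (D(r) + D(s)),
    where |b| >= 1 provides the factor s/r that makes the old coefficients
    negligible; iterating over dyadic radii, g(s) <= (s/r0) g(r0) + C sup D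
    (dyadic_decay), and the first term vanishes as s tends to 0.

    Oscillation. Choosing for z the constant term of p_{x,r} u,
    |u - z| <= |u - p_{x,r} u| + sum_{|b| >= 1} r^|b| |a_b(x,r)| on B_r(x), and
    both parts are already controlled (mean_oscillation_bound).

    All this is gathered in bounds_near_zero: for every T > 0 above the upper
    density, both quantities are at most C T at all small radii. Letting T
    decrease to the density gives the limsup estimates, and the limits are 0
    where the density vanishes. *)

(** * Norms of inner products *)

Section InnerProductNorm.
Context (R : realType) (V : lmodType R) (dot : {dot V for idfun}).

Lemma ipnorm_ge0 v : 0 <= ipnorm dot v.
Proof. exact: sqrtr_ge0. Qed.

Lemma ipnormZ k v : ipnorm dot (k *: v) = `|k| * ipnorm dot v.
Proof.
rewrite /ipnorm linearZl_LR linearZr_LR /= /GRing.scale /= mulrA -expr2.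
by rewrite sqrtrM ?sqr_ge0// sqrtr_sqr.
Qed.

Lemma ipnorm0 : ipnorm dot 0 = 0.
Proof. by rewrite -(scale0r 0) ipnormZ normr0 mul0r. Qed.

Lemma ipnormN v : ipnorm dot (- v) = ipnorm dot v.
Proof. by rewrite -scaleN1r ipnormZ normrN1 mul1r. Qed.

Lemma ipnormD v w : ipnorm dot (v + w) <= ipnorm dot v + ipnorm dot w.
Proof.
rewrite -(ler_pXn2r (ltn0Sn 1)) ?nnegrE ?addr_ge0 ?ipnorm_ge0//.
have sq x : ipnorm dot x ^+ 2 = dot x x by rewrite sqr_sqrtr// dot_ge0.
rewrite sqrrD !sq linearDl /= !linearDr /= (dotC dot w v).
have := le_trans (ler_norm _) (cauchy_schwarz dot v w); lra.
Qed.

Lemma ipnormB v w : ipnorm dot (v - w) <= ipnorm dot v + ipnorm dot w.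
Proof. by rewrite -(ipnormN w) ipnormD. Qed.

Lemma ipnorm_sum (I : Type) (r : seq I) (P : pred I) (F : I -> V) :
  ipnorm dot (\sum_(i <- r | P i) F i) <= \sum_(i <- r | P i) ipnorm dot (F i).
Proof.
elim/big_ind2: _ => [|x a y b xa yb|//]; first by rewrite ipnorm0.
by rewrite (le_trans (ipnormD _ _)) ?lerD.
Qed.

End InnerProductNorm.

(** * Recovering polynomial coefficients from values near a grid *)

Section Interpolation.
Context (R : realType) (n l : nat).
Implicit Types (b J : mindex n l).

(** The coefficients k are the entries of the inverse Vandermonde matrix. *)
Lemma vandermonde_dual (F : fieldType) (t : 'I_l -> F) : injective t ->
  exists k : 'I_l -> 'I_l -> F,
    forall i i0 : 'I_l, \sum_j k i j * t j ^+ i0 = (i == i0)%:R.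
Proof.
move=> tI; pose M := Vandermonde l (\row_j t j).
have uM : M \in unitmx.
  rewrite unitmxE det_Vandermonde unitfE prodf_seq_neq0; apply/allP => i _ /=.
  rewrite prodf_seq_neq0; apply/allP => j _; apply/implyP => ij.
  rewrite !mxE subr_eq0; apply: contraTneq ij => /tI ->.
  by rewrite ltnn.
exists (fun i j => invmx M j i) => b b'.
have := congr1 (fun X : 'M[F]_l => X b' b) (mulmxV uM).
rewrite !mxE eq_sym => <-; apply: eq_bigr => j _.
by rewrite !mxE mulrC.
Qed.

Definition gridpt (t : 'I_l -> R) J : 'rV[R]_n := \row_i t (J i).

(** The dual basis of the monomials on the tensor grid is the tensor product of
    the one-dimensional dual bases, by distributivity of product over sum. *)
Lemma gridpt_dual (t : 'I_l -> R) : injective t ->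
  exists k : mindex n l -> mindex n l -> R,
    forall b b', \sum_J k b J * monomial b' (gridpt t J) = (b == b')%:R.
Proof.
move=> /vandermonde_dual[k kP].
exists (fun b J => \prod_i k (b i) (J i)) => b b'.
transitivity (\prod_(i < n) \sum_j k (b i) j * t j ^+ b' i).
  rewrite bigA_distr_bigA /=; apply: eq_bigr => J _.
  by rewrite /monomial -big_split /=; apply: eq_bigr => i _; rewrite mxE.
under eq_bigr do rewrite kP.
have [->|bb] := eqVneq b b'; first by rewrite big1// => i _; rewrite eqxx.
have [i bi] : exists i, b i != b' i.
  apply/existsP; apply: contraNT bb; rewrite negb_exists => /forallP h.
  by apply/eqP/ffunP => i; apply/eqP; rewrite -[_ == _]negbK h.
by apply/eqP/prodf_eq0; exists i => //; rewrite (negbTE bi).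
Qed.

Lemma continuous_monomial b : continuous (@monomial R n l b).
Proof.
move=> x; rewrite /monomial; elim: (index_enum _) => [|i s IH].
  by under eq_fun do rewrite big_nil; exact: cst_continuous.
under eq_fun do rewrite big_cons.
have cX k : continuous_at x (fun y : 'rV[R]_n => y 0 i ^+ k).
  elim: k => [|k IHk]; first exact: cst_continuous.
  under eq_fun do rewrite exprS.
  apply: (@continuousM R _ (fun y : 'rV[R]_n => y 0 i)) => //.
  exact: coord_continuous.
exact: (continuousM (cX _) IH).
Qed.

Lemma monomial_near (z : 'rV[R]_n) b (e : R) : 0 < e ->
  \forall d \near 0^'+, forall y : 'rV[R]_n, (forall i, `|y 0 i - z 0 i| <= d) ->
    `|monomial b y - monomial b z| <= e.
Proof.
move=> e0; have /cvgrPdist_le/(_ _ e0)/nbhs_ballP[d /= d0 dP] :=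
  @continuous_monomial b z.
apply: filterS (nbhs_right_lt d0) => c cd y yz.
rewrite distrC; apply: dP; split => // i j.
by rewrite ord1 /ball /= distrC (le_lt_trans (yz _)).
Qed.

(** With exact grid points the dual basis bounds the sum N of the coefficients.
    Moving the points by d changes the values by at most e * N, where e tends
    to 0 with d; once e times the norm of the dual basis is at most 1/2, this
    error is absorbed into the left-hand side. The admissible d and the constant
    depend on the grid alone, not on the space of coefficients. *)
Lemma grid_stability (t : 'I_l -> R) : injective t ->
  exists2 K : R, 0 < K &
  \forall d \near 0^'+, forall (V : lmodType R) (dV : {dot V for idfun})
    (al : mindex n l -> V) (y : mindex n l -> 'rV[R]_n) (S : R),
    (forall J i, `|y J 0 i - gridpt t J 0 i| <= d) ->
    (forall J, ipnorm dV (\sum_b monomial b (y J) *: al b) <= S) ->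
    forall b, ipnorm dV (al b) <= K * S.
Proof.
move=> /gridpt_dual[k kP].
pose K := \sum_b \sum_J `|k b J|.
have K0 : 0 <= K by rewrite !sumr_ge0// => ? _; rewrite sumr_ge0.
exists (2 * (K + 1)); first lra.
(* Chosen so that K * e <= 1/2, which allows the absorption below. *)
pose e := (2 * (K + 1))^-1.
have e0 : 0 < e by rewrite invr_gt0; lra.
have : \forall d \near 0^'+, forall J b (y : 'rV[R]_n),
    (forall i, `|y 0 i - gridpt t J 0 i| <= d) ->
    `|monomial b y - monomial b (gridpt t J)| <= e.
  by do 2!apply: filter_forall => ?; exact: monomial_near.
apply: filterS => d dP V dV al y S yd yS.
pose P (z : 'rV[R]_n) := \sum_b monomial b z *: al b.
pose N := \sum_b ipnorm dV (al b).
have N0 : 0 <= N by rewrite sumr_ge0// => ? _; exact: ipnorm_ge0.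
have PJ J : ipnorm dV (P (gridpt t J)) <= S + e * N.
  rewrite -[P _](subrK (P (y J))) (le_trans (ipnormD _ _ _))// addrC lerD ?yS//.
  rewrite /P -sumrB (le_trans (ipnorm_sum _ _ _ _))// mulr_sumr ler_sum// => b _.
  rewrite -scalerBl ipnormZ ler_wpM2r ?ipnorm_ge0// distrC; exact: dP.
have alE b : al b = \sum_J k b J *: P (gridpt t J).
  under eq_bigr do rewrite /P scaler_sumr.
  rewrite exchange_big /=; under eq_bigr do
    (under eq_bigr do rewrite scalerA; rewrite -scaler_suml kP).
  rewrite (bigD1 b)//= eqxx scale1r big1 ?addr0// => b' /negbTE.
  by rewrite eq_sym => ->; rewrite scale0r.
have NK : N <= K * (S + e * N).
  rewrite /N /K mulr_suml ler_sum// => b _; rewrite {1}alE.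
  rewrite (le_trans (ipnorm_sum _ _ _ _))// mulr_suml ler_sum// => J _.
  by rewrite ipnormZ ler_wpM2l.
have Ke : K * e <= 2^-1.
  by rewrite /e ler_pdivrMr; lra.
have NS : N <= 2 * K * S.
  have := ler_wpM2r N0 Ke; move: NK; rewrite mulrDr mulrA; lra.
move=> b; have bN : ipnorm dV (al b) <= N.
  by rewrite /N (bigD1 b)//= lerDl sumr_ge0// => ? _; exact: ipnorm_ge0.
have S0 : 0 <= S by rewrite (le_trans _ (yS b))// ipnorm_ge0.
lra.
Qed.

End Interpolation.

(** * Measurability of vector-valued functions *)

Lemma measurable_sqrt (R : realType) : measurable_fun setT (@Num.sqrt R).
Proof. by apply: continuous_measurable_fun; exact: sqrt_continuous. Qed.

Section Measurability.
Context (R : realType) (V : vectType R) (dV : {dot V for idfun}).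

(** The pairings of v with the vectors of a basis determine v, because the form
    is definite; a linear left inverse of this injection provides the g i. It
    turns measurability of all scalar functions <f, w> into that of |f|. *)
Lemma dot_coord : exists g : 'I_(\dim {:V}) -> V,
  forall v, v = \sum_(i < \dim {:V}) dV v (vbasis {:V})`_i *: g i.
Proof.
pose T v : 'rV[R]_(\dim {:V}) := \row_i dV v (vbasis {:V})`_i.
have Tl : linear T.
  by move=> k v w; apply/rowP => i; rewrite !mxE linearPl.
pose Tl' := GRing.isLinear.Build _ _ _ _ _ Tl.
pose TL : {linear V -> 'rV[R]_(\dim {:V})} := HB.pack T Tl'.
pose h := linfun TL.
have hE v : h v = T v by rewrite lfunE.
have /lker0_lfunK hK : lker h == 0%VS.
  rewrite -subv0; apply/subvP => v; rewrite memv_ker hE => /eqP Tv0.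
  rewrite memv0; apply: contraTT (lexx (0 : R)) => v0.
  have := @neq0_dnorm_gt0 _ _ _ dV _ v0; rewrite -ltNge.
  suff -> : dV v v = 0 by [].
  rewrite {2}(coord_vbasis (memvf v)) linear_sumr big1// => i _.
  have := congr1 (fun w : 'rV[R]_(\dim {:V}) => w 0 i) Tv0; rewrite !mxE.
  by rewrite linearZr_LR /= => ->; rewrite /GRing.scale /= mulr0.
exists (fun i => (h^-1)%VF (delta_mx 0 i)) => v.
rewrite -[LHS]hK hE [T v]row_sum_delta linear_sum /=; apply: eq_bigr => i _.
by rewrite linearZ /= mxE.
Qed.

Lemma measurable_ipnorm d (T : measurableType d) (D : set T) (f : T -> V) :
  (forall v, measurable_fun D (fun y => dV (f y) v)) ->
  measurable_fun D (fun y => ipnorm dV (f y)).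
Proof.
move=> mf; have [g gP] := dot_coord.
apply: measurableT_comp; first exact: measurable_sqrt.
under eq_fun => y.
  rewrite {2}[f y]gP linear_sumr; under eq_bigr do rewrite linearZr_LR /=.
  over.
apply: measurable_sum => i; apply: measurable_funM; exact: mf.
Qed.

End Measurability.

(** * Euclidean balls and cubes *)

Section Geometry.
Context (R : realType) (n : nat).
Implicit Types (x y z : 'rV[R]_n) (d r : R).

Lemma norm_coord_le_enorm x i : `|x 0 i| <= enorm x.
Proof.
rewrite -sqrtr_sqr ler_wsqrtr// (bigD1 i)//= lerDl sumr_ge0// => j _.
exact: sqr_ge0.
Qed.

Lemma enorm_le x d : (forall i, `|x 0 i| <= d) -> enorm x <= n%:R * d.
Proof.
case: n x => [x _|m x xd]; first by rewrite mul0r /enorm big_ord0 sqrtr0.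
have d0 : 0 <= d by rewrite (le_trans _ (xd 0)).
rewrite -[leRHS]ger0_norm ?mulr_ge0// -sqrtr_sqr ler_wsqrtr// exprMn.
apply: (@le_trans _ _ (\sum_(i < m.+1) d ^+ 2)).
  by apply: ler_sum => i _; rewrite -real_normK ?num_real// lerXn2r ?nnegrE.
rewrite sumr_const card_ord -[leLHS]mulr_natl ler_wpM2r ?sqr_ge0//.
by rewrite expr2 ler_peMl// ler1n.
Qed.

(** A product of open intervals, hence covered by lebesgueRn_box. *)
Definition cube z d : set (borelRn R n) :=
  [set y : 'rV[R]_n | forall i, `](z 0 i - d), (z 0 i + d)[%classic (y 0 i)].

Lemma cubeP z d y : cube z d y <-> forall i, `|y 0 i - z 0 i| < d.
Proof.
by split=> h i; have := h i; rewrite /= in_itv /= ltr_distl.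
Qed.

Lemma measurable_cube z d : measurable (cube z d).
Proof.
have -> : cube z d = \bigcap_(i : 'I_n)
    ((fun y : borelRn R n => y 0 i) @^-1` `](z 0 i - d), (z 0 i + d)[%classic).
  by apply/seteqP; split => x /= h i => [_|]; exact: h.
apply: fin_bigcap_measurable => [|i _]; first exact: finite_finset.
by rewrite -[X in measurable X]setTI; exact: measurable_coord_rV.
Qed.

Lemma lebesgueRn_cube z d : 0 < d ->
  lebesgueRn R n (cube z d) = ((2 * d) ^+ n)%:E.
Proof.
move=> d0.
rewrite (lebesgueRn_box (A := fun i => `](z 0 i - d), (z 0 i + d)[%classic)) //.
under eq_bigr => i _.
  rewrite lebesgue_measure_itv /= lte_fin ifT; last by lra.
  rewrite -EFinB (_ : _ - _ = 2 * d)%R; last by ring.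
  over.
by rewrite prodEFin prodr_const card_ord.
Qed.

Lemma measurable_eball x r : measurable (eball x r : set (borelRn R n)).
Proof.
rewrite /eball /= -[X in measurable X]setTI.
have mf : measurable_fun setT (fun y : borelRn R n => enorm (y - x)).
  apply: measurableT_comp; first exact: measurable_sqrt.
  apply: measurable_sum => i; apply: measurable_funX.
  under eq_fun do rewrite !mxE.
  by apply: measurable_funB => //; exact: measurable_coord_rV.
have := mf measurableT `]-oo, r[%classic (measurable_itv _).
congr (measurable _); apply/seteqP; split => y /=; rewrite in_itv //=.
Qed.

(** The bound 1/(2n) is crude: the sup norm dominates the Euclidean norm up to
    the factor n, so points of this cube are within r/2 of x. *)
Lemma cube_sub_eball x z r d : (0 < n)%N -> 0 < r ->
  (forall i, `|z 0 i| + d <= (2 * n%:R)^-1) ->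
  cube (x + r *: z) (r * d) `<=` eball x r.
Proof.
move=> n0 r0 zd y /cubeP yz.
have nR : 0 < n%:R :> R by rewrite ltr0n.
apply: (@le_lt_trans _ _ (n%:R * (r * (2 * n%:R)^-1))); last first.
  rewrite (_ : _ * _ = r / 2); first lra.
  by field; rewrite gt_eqF.
apply: enorm_le => i; rewrite !mxE.
rewrite -(subrK (r * z 0 i) (_ - _)) (le_trans (ler_normD _ _))//.
have := yz i; rewrite !mxE opprD addrA normrM (gtr0_norm r0) => /ltW yd.
by rewrite (le_trans (lerD yd (lexx _)))// addrC -mulrDr ler_wpM2l// ltW.
Qed.

Lemma eball_sub_cube x r : eball x r `<=` cube x r.
Proof.
move=> y yr; apply/cubeP => i; apply: le_lt_trans yr.
by have := norm_coord_le_enorm (y - x) i; rewrite !mxE.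
Qed.

Lemma eball_sub_open (O : set 'rV[R]_n) x : open O -> O x ->
  \forall r \near 0^'+, eball x r `<=` O.
Proof.
move=> oO Ox; have /nbhs_ballP[e /= e0 eO] : nbhs x O by exact: open_nbhs_nbhs.
apply: filterS (nbhs_right_lt e0) => r re y /eball_sub_cube/cubeP yr.
apply: eO; split => // i j; rewrite ord1 /ball /= distrC.
exact: lt_trans (yr j) re.
Qed.

End Geometry.

(** * The exponent n/(n-1) and Chebyshev's argument *)

Section Exponents.
Context (R : realType) (n : nat).
Context (n2 : (2 <= n)%N).
Let q : R := n%:R / n.-1%:R.
Let q' : R := n.-1%:R / n%:R.

Lemma sobolev_exp_gt0 : 0 < n%:R :> R /\ 0 < n.-1%:R :> R.
Proof. by split; rewrite ltr0n; case: n n2 => [|[]]. Qed.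

Lemma sobolev_exp_ge1 : 1 <= q.
Proof.
have [? ?] := sobolev_exp_gt0; rewrite /q ler_pdivlMr// mul1r ler_nat; exact: leq_pred.
Qed.

Lemma sobolev_expK : q * q' = 1.
Proof. by have [? ?] := sobolev_exp_gt0; rewrite /q /q'; field; rewrite !gt_eqF. Qed.

(** This identity turns volumes of n-dimensional cubes into the (n-1)-st power
    of the radius that normalises the density. *)
Lemma powR_sobolev (w : R) : 0 <= w -> (w ^+ n.-1) `^ q = w ^+ n.
Proof.
have [? ?] := sobolev_exp_gt0 => w0; rewrite -!powR_mulrn// -powRrM; congr (_ `^ _).
by rewrite /q; field; rewrite gt_eqF.
Qed.

Lemma poweR_sobolev_exp_le (I : \bar R) (E : R) : (0 <= I)%E -> 0 <= E ->
  (I `^ q' <= E%:E)%E -> (I <= (E `^ q)%:E)%E.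
Proof.
move=> I0 E0 IE; rewrite -[I]poweRe1// -sobolev_expK mulrC poweRrM -poweR_EFin.
have q0 : 0 <= q by rewrite (le_trans ler01 sobolev_exp_ge1).
apply: gt0_ler_poweR => //; rewrite in_itv/= leey andbT ?lee_fin//.
exact: poweR_ge0.
Qed.

Lemma poweR_sobolevV_le (I : \bar R) (E : R) : (0 <= I)%E -> 0 <= E ->
  (I <= (E `^ q)%:E)%E -> (I `^ q' <= E%:E)%E.
Proof.
move=> I0 E0 IE; rewrite -[leRHS]poweRe1// -sobolev_expK poweRrM poweR_EFin.
have q0 : 0 <= q' by rewrite divr_ge0.
apply: gt0_ler_poweR => //; rewrite in_itv/= leey andbT//.
by rewrite lee_fin powR_ge0.
Qed.

End Exponents.

(** If f or g exceeded S at each point of Q, then f^q + g^q >= S^q on Q and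
    integration would give (3 E)^q <= 2 E^q, which is absurd for q >= 1. *)
Lemma common_small_point d (T : measurableType d) (R : realType)
    (mu : {measure set T -> \bar R}) (Q : set T) (f g : T -> R) (q E S v : R) :
  measurable Q -> mu Q = v%:E -> 1 <= q -> 0 < E -> 0 <= S ->
  S `^ q * v = (3 * E) `^ q ->
  (forall y, 0 <= f y) -> (forall y, 0 <= g y) ->
  measurable_fun Q f -> measurable_fun Q g ->
  (\int[mu]_(y in Q) (f y `^ q)%:E <= (E `^ q)%:E)%E ->
  (\int[mu]_(y in Q) (g y `^ q)%:E <= (E `^ q)%:E)%E ->
  exists y, [/\ Q y, f y <= S & g y <= S].
Proof.
move=> mQ muQ q1 E0 S0 SE f0 g0 mf mg If Ig; apply: contrapT => h.
have q0 : 0 <= q by rewrite (le_trans ler01).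
have fg y : Q y -> S `^ q <= f y `^ q + g y `^ q.
  move=> Qy; have [fS|fS] := leP (f y) S.
    have [gS|gS] := leP (g y) S; first by case: h; exists y.
    by rewrite ler_wpDl ?powR_ge0// ge0_ler_powR ?nnegrE// ltW.
  by rewrite ler_wpDr ?powR_ge0// ge0_ler_powR ?nnegrE// ltW.
have mpow k : measurable_fun Q k -> measurable_fun Q (fun y => (k y `^ q)%:E).
  by move=> mk; apply/measurable_EFinP/(measurableT_comp (measurable_powR q)).
have : ((S `^ q * v)%:E <= (E `^ q + E `^ q)%:E)%E.
  rewrite EFinM -muQ -integral_cst// EFinD.
  apply: le_trans (leeD If Ig).
  rewrite -ge0_integralD//; try exact: mpow; try by move=> *; rewrite lee_fin powR_ge0.
  apply: ge0_le_integral => //; first by move=> *; rewrite lee_fin powR_ge0.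
  by apply: emeasurable_funD; exact: mpow.
rewrite lee_fin SE powRM ?(ltW E0)//.
have Eq : 0 < E `^ q by exact: powR_gt0.
have : (3 : R) <= 3 `^ q by rewrite le1r_powR//; lra.
by move=> /(ler_wpM2r (ltW Eq)) h3 h2; move: (le_trans h3 h2) Eq; lra.
Qed.

(** * Polynomials on balls *)

Section PolynomialsOnBalls.
Context (R : realType) (n l : nat) (V : vectType R) (dV : {dot V for idfun}).
Context (n2 : (2 <= n)%N).
Implicit Types (x : 'rV[R]_n) (al : mindex n l -> V) (u : 'rV[R]_n -> V).
Let q : R := n%:R / n.-1%:R.

(** All multi-indices of the finite type are summed over; a bound on the total
    degree is expressed by vanishing coefficients. *)
Definition mpolynomial x al (y : 'rV[R]_n) : V :=
  \sum_b monomial b (y - x) *: al b.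

Lemma monomialZ (s : R) (b : mindex n l) (z : 'rV[R]_n) :
  monomial b (s *: z) = s ^+ mdegree b * monomial b z.
Proof.
rewrite /monomial /mdegree -prodrXr -big_split /=.
by apply: eq_bigr => i _; rewrite mxE exprMn.
Qed.

Lemma measurable_sub_mpolynomial (D : set (borelRn R n)) u x al :
  measurable D ->
  (forall v, measurable_fun D (fun y => dV (u y) v)) ->
  measurable_fun D (fun y => ipnorm dV (u y - mpolynomial x al y)).
Proof.
move=> mD mu; apply: measurable_ipnorm => v.
under eq_fun do rewrite linearBl /= /mpolynomial linear_sumlz /=.
apply: measurable_funB => //; apply: measurable_sum => b.
under eq_fun do rewrite linearZl_LR /=.
apply: measurable_funM => //; apply: measurable_prod => i _.
apply: measurable_funX; under eq_fun do rewrite !mxE.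
apply: measurable_funB => //.
exact: measurable_funS (@measurable_coord_rV R n i).
Qed.

Lemma integral_le_of_Lstar (E : R) (D : set (borelRn R n)) (f : 'rV[R]_n -> V) : 0 <= E ->
  (Lstar_norm dV D f <= E%:E)%E ->
  (\int[lebesgueRn R n]_(y in D) (ipnorm dV (f y) `^ q)%:E <= (E `^ q)%:E)%E.
Proof.
move=> E0; apply: poweR_sobolev_exp_le => //.
by apply: integral_ge0 => y _; rewrite lee_fin powR_ge0.
Qed.

(** Two polynomials that are both close to u in mean on a ball have close
    coefficients: near each point of a rescaled grid there is a point where both
    are close to u, hence to each other, and grid_stability applies to their
    difference after rescaling the ball to the unit ball. *)
Lemma coefficient_comparison : (0 < l)%N -> exists2 C : R, 0 < C &
  forall x (s T : R) u al al', 0 < s -> 0 < T ->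
    (forall v, measurable_fun (eball x s : set (borelRn R n))
       (fun y => dV (u y) v)) ->
    (Lstar_norm dV (eball x s) (fun y => u y - mpolynomial x al y)%R
       <= (T * s ^+ n.-1)%:E)%E ->
    (Lstar_norm dV (eball x s) (fun y => u y - mpolynomial x al' y)%R
       <= (T * s ^+ n.-1)%:E)%E ->
    forall b, s ^+ mdegree b * ipnorm dV (al b - al' b) <= C * T.
Proof.
move=> l0; have n0 : (0 < n)%N by exact: ltnW.
have nR : 0 < n%:R :> R by rewrite ltr0n.
have lR : 0 < l%:R :> R by rewrite ltr0n.
(* Nodes below 1/(4n) and cubes of half-side at most 1/(4n) stay inside the
   ball by cube_sub_eball. *)
pose t (j : 'I_l) : R := j%:R / (4 * n%:R * l%:R).
have tI : injective t.
  move=> i j /mulIf; rewrite gt_eqF ?invr_gt0 ?mulr_gt0//.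
  by move=> /(_ isT) /eqP; rewrite eqr_nat => /eqP/val_inj.
have t0 j : 0 <= t j by rewrite divr_ge0 ?mulr_ge0// ltW.
have tle j : t j <= (4 * n%:R)^-1.
  rewrite /t ler_pdivrMr ?mulr_gt0// mulrA mulVf ?mul1r ?gt_eqF ?mulr_gt0//.
  by rewrite ler_nat ltnW.
have [K K0 /= gridK] := @grid_stability R n l t tI.
have d0 : 0 < (4 * n%:R)^-1 :> R by rewrite invr_gt0 mulr_gt0.
have := @filter_ex _ _ _ _
  (filterI (nbhs_right_gt 0) (filterI (nbhs_right_le d0) gridK)).
move=> /(_ _)[d [{}d0 [dle {}gridK]]].
(* Solves S^q * (volume of the cube of half-side s d) = (3 T s^(n-1))^q; the
   powers of s cancel. *)
pose S (T : R) := 3 * T / (2 * d) ^+ n.-1.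
exists (2 * K * 3 / (2 * d) ^+ n.-1).
  by rewrite divr_gt0 ?mulr_gt0// exprn_gt0 ?mulr_gt0.
move=> x s T u al al' s0 T0 mu ual ual' b.
have w0 : 0 < 2 * (s * d) by rewrite !mulr_gt0.
have E0 : 0 < T * s ^+ n.-1 by rewrite mulr_gt0 ?exprn_gt0.
have subB J : cube (x + s *: gridpt t J) (s * d) `<=` eball x s.
  apply: cube_sub_eball => // i; rewrite mxE ger0_norm//.
  have := tle (J i); have : 2 * (4 * n%:R)^-1 = (2 * n%:R)^-1 :> R.
    by field; rewrite gt_eqF.
  lra.
have mP a : measurable_fun (eball x s : set (borelRn R n))
    (fun y => ipnorm dV (u y - mpolynomial x a y)).
  by apply: measurable_sub_mpolynomial => //; exact: measurable_eball.
have intP a J :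
    (Lstar_norm dV (eball x s) (fun y => u y - mpolynomial x a y)%R
       <= (T * s ^+ n.-1)%:E)%E ->
    (\int[lebesgueRn R n]_(y in cube (x + s *: gridpt t J) (s * d))
       (ipnorm dV (u y - mpolynomial x a y) `^ q)%:E
       <= ((T * s ^+ n.-1) `^ q)%:E)%E.
  move=> /(integral_le_of_Lstar (ltW E0)); apply: le_trans.
  apply: ge0_subset_integral => //; first exact: measurable_cube.
  - exact: measurable_eball.
  - by apply/measurable_EFinP/(measurableT_comp (measurable_powR q)); exact: mP.
  - by move=> y _; rewrite lee_fin powR_ge0.
have point J : exists y, [/\ cube (x + s *: gridpt t J) (s * d) y,
    ipnorm dV (u y - mpolynomial x al y) <= S T
    & ipnorm dV (u y - mpolynomial x al' y) <= S T].
  apply: (@common_small_point _ _ R (lebesgueRn R n) _ _ _ q (T * s ^+ n.-1) _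
    ((2 * (s * d)) ^+ n)) => //.
  - exact: measurable_cube.
  - by apply: lebesgueRn_cube; rewrite mulr_gt0.
  - exact: sobolev_exp_ge1.
  - by rewrite divr_ge0 ?mulr_ge0 ?exprn_ge0 ?mulr_ge0// ltW.
  - rewrite -(@powR_sobolev _ _ n2) ?(ltW w0)// -powRM.
    + congr (_ `^ _); rewrite /S !exprMn; field.
      by rewrite !expf_neq0 ?gt_eqF.
    + by rewrite divr_ge0 ?mulr_ge0 ?exprn_ge0 ?mulr_ge0// ltW.
    + by rewrite exprn_ge0 ?ltW.
  - by move=> y; exact: ipnorm_ge0.
  - by move=> y; exact: ipnorm_ge0.
  - by apply: measurable_funS (mP al) => //; exact: measurable_eball.
  - by apply: measurable_funS (mP al') => //; exact: measurable_eball.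
  - exact: (intP al J ual).
  - exact: (intP al' J ual').
have [y yP] := choice point.
pose Y J : 'rV[R]_n := s^-1 *: (y J - x).
pose be b' := s ^+ mdegree b' *: (al b' - al' b').
have YE J : y J - x = s *: Y J by rewrite scalerA mulfV ?gt_eqF// scale1r.
have Yt J i : `|Y J 0 i - gridpt t J 0 i| <= d.
  have [/cubeP/(_ i) + _ _] := yP J.
  rewrite !mxE -(ltr_pM2l (_ : 0 < s^-1)) ?invr_gt0// => /ltW.
  rewrite mulKf ?gt_eqF// -{1}(gtr0_norm (_ : 0 < s^-1)) ?invr_gt0//.
  by rewrite -normrM opprD addrA mulrBr mulKf ?gt_eqF.
have YS J : ipnorm dV (\sum_b' monomial b' (Y J) *: be b') <= S T + S T.
  have -> : \sum_b' monomial b' (Y J) *: be b' =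
      (u (y J) - mpolynomial x al' (y J)) - (u (y J) - mpolynomial x al (y J)).
    rewrite opprB [RHS]addrC addrA subrK /mpolynomial -sumrB; apply: eq_bigr => b' _.
    by rewrite YE monomialZ -scalerBr scalerA mulrC.
  rewrite (le_trans (ipnormB _ _ _))//.
  by have [_ zal zal'] := yP J; exact: lerD.
have := gridK V dV be Y _ Yt YS b.
rewrite ipnormZ ger0_norm ?exprn_ge0 ?(ltW s0)// => h; apply: (le_trans h).
rewrite /S le_eqVlt; apply/orP; left; apply/eqP; field.
by rewrite expf_neq0// gt_eqF ?mulr_gt0.
Qed.

(** The sum over degree 0 has a single term, the constant term; written as a sum
    it needs no name for the zero multi-index. *)
Lemma mpolynomial_oscillation x al (r T : R) y : 0 < r -> 0 < T ->
  (forall b, (0 < mdegree b)%N -> r ^+ mdegree b * ipnorm dV (al b) <= T) ->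
  eball x r y ->
  ipnorm dV (mpolynomial x al y - \sum_(b | mdegree b == 0) al b)
    <= #|mindex n l|%:R * T.
Proof.
move=> r0 T0 alT /= xy.
rewrite /mpolynomial (bigID (fun b => mdegree b == 0))/= [X in X + _ - _](eq_bigr al).
  rewrite addrC addKr (le_trans (ipnorm_sum _ _ _ _))//.
  rewrite mulr_natl -sumr_const big_mkcond/= ler_sum// => b _.
  case: ifPn => [|_]; last exact: ltW.
  rewrite -lt0n => b0; apply: le_trans (alT _ b0); rewrite ipnormZ.
  rewrite ler_wpM2r ?ipnorm_ge0// /monomial /mdegree -prodrXr normr_prod.
  apply: ler_prod => i _; rewrite normr_ge0 normrX lerXn2r ?nnegrE ?(ltW r0)//.
  by rewrite (le_trans (norm_coord_le_enorm _ _))// ltW.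
move=> b /eqP b0; rewrite /monomial big1 ?scale1r// => i _.
by move/eqP: b0; rewrite sum_nat_eq0 => /forallP/(_ i)/eqP ->.
Qed.

(** The constant term of the polynomial is a competitor in the infimum. The
    volume of the ball is only compared with those of an inscribed and a
    circumscribed cube, which costs the factor n^n inside D. *)
Lemma mean_oscillation_bound : exists2 C : R, 0 < C &
  forall x (r T : R) u al, 0 < r -> 0 < T ->
    (forall v, measurable_fun (eball x r : set (borelRn R n))
       (fun y => dV (u y) v)) ->
    (Lstar_norm dV (eball x r) (fun y => u y - mpolynomial x al y)%R
       <= (T * r ^+ n.-1)%:E)%E ->
    (forall b, (0 < mdegree b)%N -> r ^+ mdegree b * ipnorm dV (al b) <= T) ->
    (mean_oscillation dV u x r <= (C * T)%:E)%E.
Proof.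
have n0 : (0 < n)%N by exact: ltnW.
have nR : 0 < n%:R :> R by rewrite ltr0n.
have q1 : 1 <= q by exact: sobolev_exp_ge1.
have q0 : 0 <= q by rewrite (le_trans ler01).
pose N : R := #|mindex n l|%:R.
pose D : R := n%:R ^+ n + N `^ q.
have D0 : 0 < D by rewrite ltr_wpDr ?powR_ge0// exprn_gt0.
exists (2 * D `^ (n.-1%:R / n%:R)); first by rewrite mulr_gt0// powR_gt0.
move=> x r T u al r0 T0 mu ual alT.
have mB : measurable (eball x r : set (borelRn R n)) by exact: measurable_eball.
pose L := lebesgueRn R n (eball x r).
have [Ly Ln] : (L < +oo)%E /\ (((r / n%:R) ^+ n)%:E <= L)%E.
  split.
    apply: (@le_lt_trans _ _ (lebesgueRn R n (cube x r))).
      apply: le_measure; rewrite ?inE//; first exact: measurable_cube.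
      exact: eball_sub_cube.
    rewrite [X in (X < _)%E](lebesgueRn_cube x r0); exact: ltry.
  have dn : 0 < r * (2 * n%:R)^-1 :> R by rewrite mulr_gt0// invr_gt0 mulr_gt0.
  rewrite (_ : r / n%:R = 2 * (r * (2 * n%:R)^-1)); last first.
    by field; rewrite gt_eqF.
  rewrite -(lebesgueRn_cube x dn).
  apply: le_measure; rewrite ?inE//; first exact: measurable_cube.
  rewrite -[in cube _ _](addr0 x) -(scaler0 _ r); apply: cube_sub_eball => // i.
  by rewrite mxE normr0 add0r.
have L0 : 0 < fine L.
  rewrite fine_gt0// Ly andbT (lt_le_trans _ Ln)// lte_fin exprn_gt0//.
  exact: divr_gt0.
have LE : L = (fine L)%:E by rewrite fineK// ge0_fin_numE ?Ly// measure_ge0.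
pose z := \sum_(b | mdegree b == 0) al b.
pose f (y : borelRn R n) := ipnorm dV (u y - mpolynomial x al y).
pose I := (\int[lebesgueRn R n]_(y in eball x r) (ipnorm dV (u y - z) `^ q)%:E)%E.
have mpow k : measurable_fun (eball x r : set (borelRn R n)) k ->
    measurable_fun (eball x r : set (borelRn R n)) (fun y => (k y `^ q)%:E).
  by move=> mk; apply/measurable_EFinP/(measurableT_comp (measurable_powR q)).
have mf : measurable_fun (eball x r : set (borelRn R n)) f.
  exact: measurable_sub_mpolynomial.
have mz : measurable_fun (eball x r : set (borelRn R n))
    (fun y => ipnorm dV (u y - z)).
  apply: measurable_ipnorm => v; under eq_fun do rewrite linearBl /=.
  exact: measurable_funB.
have NT0 : 0 <= N * T by rewrite mulr_ge0 ?(ltW T0)// ler0n.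
have fz y : eball x r y ->
    ipnorm dV (u y - z) `^ q <= 2 `^ q * (f y `^ q + (N * T) `^ q).
  move=> /(mpolynomial_oscillation r0 T0 alT) Pz.
  have uz : ipnorm dV (u y - z) <= f y + N * T.
    rewrite -(subrK (mpolynomial x al y) (u y)) -addrA.
    by rewrite (le_trans (ipnormD _ _ _))// lerD.
  have f0 : 0 <= f y by exact: ipnorm_ge0.
  have [fN|fN] := leP (f y) (N * T).
    apply: (@le_trans _ _ ((2 * (N * T)) `^ q)).
      by rewrite ge0_ler_powR ?nnegrE ?ipnorm_ge0//; lra.
    by rewrite powRM// ler_wpM2l ?powR_ge0// lerDr powR_ge0.
  apply: (@le_trans _ _ ((2 * f y) `^ q)).
    by rewrite ge0_ler_powR ?nnegrE ?ipnorm_ge0//; lra.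
  by rewrite powRM// ler_wpM2l ?powR_ge0// lerDl powR_ge0.
have E0 : 0 <= T * r ^+ n.-1 by rewrite mulr_ge0 ?exprn_ge0 ?ltW.
have Ile : (I <= (2 `^ q * ((T * r ^+ n.-1) `^ q + (N * T) `^ q * fine L))%:E)%E.
  have -> : ((2 `^ q * ((T * r ^+ n.-1) `^ q + (N * T) `^ q * fine L))%:E =
      (2 `^ q)%:E * (((T * r ^+ n.-1) `^ q)%:E + ((N * T) `^ q)%:E * L))%E.
    by rewrite [in RHS]LE.
  apply: (@le_trans _ _ (\int[lebesgueRn R n]_(y in eball x r)
      ((2 `^ q)%:E * ((f y `^ q)%:E + cst ((N * T) `^ q)%:E y)))%E).
    apply: ge0_le_integral => //.
    - by move=> y _; rewrite lee_fin powR_ge0.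
    - exact: mpow.
    - by apply: measurable_funeM; apply: emeasurable_funD => //; exact: mpow.
  rewrite ge0_integralZl_EFin ?powR_ge0//; first last.
  - by apply: emeasurable_funD => //; exact: mpow.
  - by move=> y _; rewrite adde_ge0// lee_fin powR_ge0.
  rewrite ge0_integralD//; first last.
  - by move=> y _; rewrite lee_fin powR_ge0.
  - exact: mpow.
  - by move=> y _; rewrite lee_fin powR_ge0.
  rewrite integral_cst// lee_wpmul2l ?lee_fin ?powR_ge0// leeD2r//.
  exact: integral_le_of_Lstar.
apply: ge_ereal_inf; eexists; first by exists z.
have I0 : (0 <= I)%E by apply: integral_ge0 => y _; rewrite lee_fin powR_ge0.
apply: (poweR_sobolevV_le n2).
- by rewrite mule_ge0// lee_fin invr_ge0 ltW.
- by rewrite !mulr_ge0 ?powR_ge0// ltW.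
rewrite -/q -/L -/I.
apply: (le_trans (lee_wpmul2l _ Ile)); first by rewrite lee_fin invr_ge0 ltW.
have -> : (2 * D `^ (n.-1%:R / n%:R) * T) `^ q = 2 `^ q * D * T `^ q.
  rewrite !powRM ?mulr_ge0 ?powR_ge0 ?(ltW T0)// -[(D `^ _) `^ _]powRrM.
  by rewrite [X in D `^ X]mulrC sobolev_expK// powRr1// ltW.
have rL : r ^+ n <= n%:R ^+ n * fine L.
  move: Ln; rewrite LE lee_fin expr_div_n ler_pdivrMr ?exprn_gt0//.
  by rewrite mulrC.
rewrite -EFinM lee_fin mulrC ler_pdivrMr//.
rewrite !powRM ?ler0n ?(ltW T0) ?exprn_ge0 ?(ltW r0)// powR_sobolev ?(ltW r0)//.
rewrite -!mulrA ler_wpM2l ?powR_ge0//.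
rewrite (_ : _ + _ = (r ^+ n + N `^ q * fine L) * T `^ q); last by ring.
rewrite [leRHS](_ : _ = (D * fine L) * T `^ q); last by ring.
by rewrite ler_wpM2r ?powR_ge0// /D mulrDl lerD2r.
Qed.

End PolynomialsOnBalls.

(** * Decay along dyadic radii *)

(** Each halving of the radius halves the contribution of g r0 and adds K to
    half of the accumulated error, so the errors sum to a geometric series
    bounded by 2 K. Radii between r0/2 and r0 are compared with r0 directly. *)
Lemma dyadic_decay (R : realType) (g : R -> R) (r0 K : R) :
  0 < r0 -> 0 <= K ->
  (forall s r, 0 < s -> s <= r -> r <= 2 * s -> r <= r0 ->
    g s <= s / r * g r + K) ->
  forall s, 0 < s -> s <= r0 -> g s <= s / r0 * g r0 + 2 * K.
Proof.
move=> r00 K0 gP.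
have step j s : 0 < s -> s <= r0 -> r0 <= 2 ^+ j * s ->
    g s <= s / r0 * g r0 + 2 * K.
  elim: j s => [|j IH] s s0 sr0 js.
    have -> : s = r0 by apply/eqP; rewrite eq_le sr0 -[s]mul1r.
    by rewrite divff ?gt_eqF//; lra.
  have [r0s|sr] := leP r0 (2 * s); first by have := gP s r0 s0 sr0 r0s (lexx _); lra.
  have [s2 s20] : s <= 2 * s /\ 0 < 2 * s by lra.
  have := IH (2 * s) s20 (ltW sr); rewrite mulrA -exprSr => /(_ js).
  have := gP s (2 * s) s0 s2 (lexx _) (ltW sr).
  have -> : s / (2 * s) = 2^-1 by field; rewrite gt_eqF.
  have -> : 2 * s / r0 * g r0 = 2 * (s / r0 * g r0) by ring.
  lra.
move=> s s0 sr0; pose j := Num.bound (r0 / s).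
apply: (step j) => //; rewrite -ler_pdivrMr//.
have := archi_boundP (ltW (divr_gt0 r00 s0)); rewrite -/j => /ltW/le_trans; apply.
by rewrite -natrX ler_nat ltnW// ltn_expl.
Qed.

(** * Upper limits *)

Section Limsup.
Context (R : realType).
Implicit Types (f : R -> \bar R) (F : set_system R).

Lemma limf_esup_lt_near f F (M : \bar R) : Filter F ->
  (limf_esup f F < M)%E -> \forall r \near F, (f r < M)%E.
Proof.
move=> FF /ereal_inf_lt[_ [A FA <-] AM]; apply: filterS FA => r Ar.
by apply: le_lt_trans AM; apply: ereal_sup_ubound; exists r.
Qed.

Lemma limf_esup_le f F (M : \bar R) :
  (\forall r \near F, (f r <= M)%E) -> (limf_esup f F <= M)%E.
Proof.
move=> fM; apply: ge_ereal_inf; eexists; first by exists [set r | (f r <= M)%E].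
by apply: ge_ereal_sup => _ [r rM <-].
Qed.

(** For th = +oo there is nothing to prove; otherwise T = th + e / C is used. *)
Lemma limf_esup_le_scale f F (C : R) (th : \bar R) : 0 < C -> (0 <= th)%E ->
  (forall T, 0 < T -> (th < T%:E)%E -> \forall r \near F, (f r <= (C * T)%:E)%E) ->
  (limf_esup f F <= C%:E * th)%E.
Proof.
move=> C0; case: th => [t|_ _|//]; last by rewrite gt0_muley ?leey.
rewrite lee_fin => t0 fC; rewrite -EFinM; apply/lee_addgt0Pr => e e0.
rewrite -EFinD; have -> : C * t + e = C * (t + e / C) by field; rewrite gt_eqF.
have eC : 0 < e / C by exact: divr_gt0.
by apply/limf_esup_le/fC; rewrite ?lte_fin; lra.
Qed.

Lemma cvg0_of_bound (g : R -> R) F (C : R) : Filter F -> 0 < C ->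
  (\forall r \near F, 0 <= g r) ->
  (forall T, 0 < T -> \forall r \near F, g r <= C * T) ->
  g r @[r --> F] --> 0.
Proof.
move=> FF C0 g0 gC; apply/cvgrPdist_le => e e0.
apply: filterS2 g0 (gC (e / C) (divr_gt0 e0 C0)) => r gr.
by rewrite sub0r normrN ger0_norm// mulrCA divff ?gt_eqF// mulr1.
Qed.

Lemma cvge0_of_bound f F (C : R) : Filter F -> 0 < C ->
  (forall r, (0 <= f r)%E) ->
  (forall T, 0 < T -> \forall r \near F, (f r <= (C * T)%:E)%E) ->
  f r @[r --> F] --> 0%E.
Proof.
move=> FF C0 f0 fC; apply/fine_cvgP; split.
  apply: filterS (fC 1 ltr01) => r fr.
  by rewrite ge0_fin_numE// (le_lt_trans fr)// ltry.
apply: (cvg0_of_bound FF C0) => [|T T0].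
  by apply: nearW => r; exact: fine_ge0.
apply: filterS (fC T T0) => r fr; rewrite -lee_fin fineK//.
by rewrite ge0_fin_numE// (le_lt_trans fr)// ltry.
Qed.


End Limsup.

(** * Bounds at small radii *)

Section SmallRadii.
Context (R : realType) (n l : nat) (V W : vectType R)
  (dV : {dot V for idfun}) (dW : {dot W for idfun}) (n2 : (2 <= n)%N) (l0 : (0 < l)%N).

Lemma Lstar_norm_subset (D E : set (borelRn R n)) (f : 'rV[R]_n -> V) :
  measurable D -> measurable E -> D `<=` E ->
  measurable_fun E (fun y => ipnorm dV (f y)) ->
  (Lstar_norm dV D f <= Lstar_norm dV E f)%E.
Proof.
move=> mD mE DE mf.
have [n0 m0] := @sobolev_exp_gt0 R n n2.
have pos (X : set (borelRn R n)) : (0 <= \int[lebesgueRn R n]_(y in X)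
    (ipnorm dV (f y) `^ (n%:R / n.-1%:R))%:E)%E.
  by apply: integral_ge0 => y _; rewrite lee_fin powR_ge0.
apply: gt0_ler_poweR.
- by rewrite divr_ge0 ?ltW.
- by rewrite in_itv /= leey andbT.
- by rewrite in_itv /= leey andbT.
apply: ge0_subset_integral => //; last by move=> y _; rewrite lee_fin powR_ge0.
by apply/measurable_EFinP/(measurableT_comp (measurable_powR _)).
Qed.

Lemma mean_oscillation_ge0 u (x : 'rV[R]_n) r : (0 <= mean_oscillation dV u x r)%E.
Proof. by apply: le_ereal_inf_tmp => _ [z _ <-]; exact: poweR_ge0. Qed.

(** Measurability matters: without a measurable partition of E the supremum is
    taken over the empty set and equals -oo. *)
Lemma vector_variation_ge0 (Au : vmeasure n dW) (E : set (borelRn R n)) :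
  measurable E -> (0 <= vector_variation Au E)%E.
Proof.
move=> mE; pose F := bigcup2 E set0.
apply: (@le_trans _ _ (\sum_(0 <= k <oo) (ipnorm dW (Au (F k)))%:E)%E).
  by apply: nneseries_ge0 => k _ _; rewrite lee_fin ipnorm_ge0.
apply: ereal_sup_ubound; exists F => //; split.
- by case=> [|[|k]]; rewrite /F /bigcup2 /=.
- by rewrite -trivIset_bigcup2 setI0.
- by rewrite bigcup2E setU0.
Qed.

Lemma upper_density_ge0 (Au : vmeasure n dW) x : (0 <= upper_density Au x)%E.
Proof.
apply: le_ereal_inf_tmp => _ [U U0 <-].
have [r [r0 Ur]] := @filter_ex _ _ _ _ (filterI (nbhs_right_gt (0 : R)) U0).
apply: (@le_trans _ _ (vector_variation Au (eball x r) * (r ^- n.-1)%:E)%E).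
  rewrite mule_ge0 ?lee_fin ?invr_ge0 ?exprn_ge0 ?(ltW r0)//.
  by apply: vector_variation_ge0; exact: measurable_eball.
by apply: ereal_sup_ubound; exists r.
Qed.

(** Quantifying over the real numbers T above the density serves both the upper
    limits (T decreasing to the density) and the limits at points of zero
    density (T decreasing to 0), and is vacuous at points of infinite density. *)
Lemma bounds_near_zero (c : R) : 0 < c -> exists2 C : R, 0 < C &
  forall (Omega : set 'rV[R]_n) (u : 'rV[R]_n -> V) (Au : vmeasure n dW)
    (p : 'rV[R]_n -> R -> 'rV[R]_n -> V)
    (a : 'rV[R]_n -> R -> mindex n l -> V),
  open Omega ->
  in_L1 dV Omega u ->
  (forall (x : 'rV[R]_n) (r : R), 0 < r -> eball x r `<=` Omega ->
    (forall y, p x r y =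
      \sum_(b : mindex n l | (mdegree b <= l.-1)%N)
         monomial b (y - x) *: a x r b) /\
    (Lstar_norm dV (eball x r) (fun y => u y - p x r y)%R
      <= c%:E * vector_variation Au (eball x r))%E) ->
  forall x T, Omega x -> 0 < T -> (upper_density Au x < T%:E)%E ->
  \forall r \near 0^'+,
    (forall b : mindex n l, (1 <= mdegree b <= l.-1)%N ->
      r ^+ mdegree b * ipnorm dV (a x r b) <= C * T) /\
    (mean_oscillation dV u x r <= (C * T)%:E)%E.
Proof.
move=> c0; have [C1 C10 C1P] := coefficient_comparison dV n2 l0.
have [C2 C20 C2P] := @mean_oscillation_bound R n l V dV n2.
(* The factor 2^(n-1) bounds (r/s)^(n-1) when r <= 2 s. *)
pose B := c * 2 ^+ n.-1.
have B0 : 0 < B by rewrite mulr_gt0 ?exprn_gt0.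
pose C3 := 1 + 2 * (C1 * B).
have C30 : 0 < C3 by have := mulr_gt0 C10 B0; rewrite /C3; lra.
exists (C3 + C2 * (C3 + c)); first by have := mulr_gt0 C20 (addr_gt0 C30 c0); lra.
move=> Omega u Au p a oO [mu _] paP x T Ox T0 dT.
(* With zero coefficients beyond degree l - 1, p x r is an mpolynomial. *)
pose al r b := if (mdegree b <= l.-1)%N then a x r b else 0.
have muO s v : eball x s `<=` Omega ->
    measurable_fun (eball x s : set (borelRn R n)) (fun y => dV (u y) v).
  move=> sO; apply: measurable_funS (mu v) => //.
  exact: sub_sigma_algebra.
have good : \forall r \near 0^'+, eball x r `<=` Omega /\
    (Lstar_norm dV (eball x r) (fun y => u y - mpolynomial x (al r) y)%R
       <= (c * T * r ^+ n.-1)%:E)%E.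
  have dTr := limf_esup_lt_near _ dT.
  near=> r; have r0 : 0 < r by [].
  have rO : eball x r `<=` Omega by near: r; exact: eball_sub_open.
  have rT : (vector_variation Au (eball x r) * (r ^- n.-1)%:E < T%:E)%E.
    by near: r; exact: dTr.
  split=> //.
  have [pE pL] := paP x r r0 rO.
  rewrite (_ : (fun y => _) = (fun y => u y - p x r y)); last first.
    apply/funext => y; rewrite pE /mpolynomial [in RHS]big_mkcond /=.
    by congr (_ - _); apply: eq_bigr => b _; rewrite /al; case: ifP; rewrite ?scaler0.
  apply: (le_trans pL); rewrite -mulrA EFinM lee_wpmul2l ?lee_fin ?(ltW c0)//.
  have rn : 0 < r ^+ n.-1 by exact: exprn_gt0.
  by rewrite EFinM -lee_pdivrMr// ltW.
  Unshelve. all: end_near.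
have [e /= e0 eP] := good.
pose r0 := e / 2.
have r00 : 0 < r0 by rewrite divr_gt0.
have {}good r : 0 < r -> r <= r0 -> eball x r `<=` Omega /\
    (Lstar_norm dV (eball x r) (fun y => u y - mpolynomial x (al r) y)%R
       <= (c * T * r ^+ n.-1)%:E)%E.
  move=> rp rr0; apply: eP => //=.
  by rewrite sub0r normrN gtr0_norm// (le_lt_trans rr0)// /r0; lra.
have step b s r : (0 < mdegree b)%N -> 0 < s -> s <= r -> r <= 2 * s -> r <= r0 ->
    s ^+ mdegree b * ipnorm dV (al s b) <=
    s / r * (r ^+ mdegree b * ipnorm dV (al r b)) + C1 * (B * T).
  move=> b0 s0 sr r2s rr0.
  have rp : 0 < r by exact: lt_le_trans sr.
  have [sO sL] := good s s0 (le_trans sr rr0).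
  have [rO rL] := good r rp rr0.
  have srB : eball x s `<=` eball x r by move=> y /= /lt_le_trans; apply.
  have pw : r ^+ n.-1 <= 2 ^+ n.-1 * s ^+ n.-1.
    by rewrite -exprMn lerXn2r ?nnegrE ?mulr_ge0 ?(ltW rp) ?(ltW s0).
  have cmp := C1P x s (B * T) u (al s) (al r) s0 (mulr_gt0 B0 T0)
    (fun v => muO s v sO).
  have ps : 0 < s ^+ n.-1 by exact: exprn_gt0.
  have cT : 0 < c * T by exact: mulr_gt0.
  have Ls : (Lstar_norm dV (eball x s) (fun y => u y - mpolynomial x (al s) y)%R
      <= (B * T * s ^+ n.-1)%:E)%E.
    apply: (le_trans sL); rewrite lee_fin ler_wpM2r ?(ltW ps)// ler_wpM2r ?(ltW T0)//.
    by rewrite ler_peMr ?(ltW c0)// exprn_ege1// ler1n.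
  have Lr : (Lstar_norm dV (eball x s) (fun y => u y - mpolynomial x (al r) y)%R
      <= (B * T * s ^+ n.-1)%:E)%E.
    apply: (@le_trans _ _ (c * T * r ^+ n.-1)%:E); last first.
      rewrite lee_fin (_ : _ * s ^+ _ = c * T * (2 ^+ n.-1 * s ^+ n.-1)).
        by rewrite ler_wpM2l ?(ltW cT).
      by rewrite /B; ring.
    apply: le_trans rL; apply: Lstar_norm_subset => //.
    - exact: measurable_eball.
    - exact: measurable_eball.
    - apply: measurable_sub_mpolynomial; first exact: measurable_eball.
      by move=> v; exact: muO.
  have {cmp Ls Lr} := cmp Ls Lr b.
  have sb : 0 < s ^+ mdegree b by exact: exprn_gt0.
  have : s ^+ mdegree b * ipnorm dV (al r b) <=
      s / r * (r ^+ mdegree b * ipnorm dV (al r b)).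
    rewrite mulrA ler_wpM2r ?ipnorm_ge0//.
    rewrite -ler_pdivrMr ?exprn_gt0// -expr_div_n -[leRHS]expr1.
    rewrite ler_wiXn2l//; first by rewrite divr_ge0 ?ltW.
    by rewrite ler_pdivrMr// mul1r.
  have : s ^+ mdegree b * ipnorm dV (al s b) <=
      s ^+ mdegree b * ipnorm dV (al r b) +
      s ^+ mdegree b * ipnorm dV (al s b - al r b).
    rewrite -mulrDr ler_wpM2l ?(ltW sb)// -{1}(subrK (al r b) (al s b)) addrC.
    exact: ipnormD.
  lra.
(* The summand 1 in C3 absorbs (r / r0) * g r0 for small r. *)
have small b : (0 < mdegree b)%N ->
    \forall r \near 0^'+, r ^+ mdegree b * ipnorm dV (al r b) <= C3 * T.
  move=> b0; set g := fun r => r ^+ mdegree b * ipnorm dV (al r b).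
  have g0 : 0 <= g r0 by rewrite mulr_ge0 ?ipnorm_ge0 ?exprn_ge0 ?(ltW r00).
  have g1 : 0 < g r0 + 1 by lra.
  have gT : 0 < T * r0 / (g r0 + 1) by rewrite divr_gt0 ?mulr_gt0.
  near=> r; have rp : 0 < r by [].
  have rr0 : r <= r0 by near: r; exact: nbhs_right_le.
  have K0 : 0 <= C1 * (B * T) by rewrite ltW// (mulr_gt0 C10)// mulr_gt0.
  have := dyadic_decay r00 K0 (fun s r => @step b s r b0) rp rr0.
  rewrite -/(g r) -/(g r0) => h; rewrite (le_trans h)//.
  have : r <= T * r0 / (g r0 + 1) by near: r; exact: nbhs_right_le.
  rewrite ler_pdivlMr// -ler_pdivrMr// => rT.
  have : 0 <= r / r0 by rewrite divr_ge0 ?ltW.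
  rewrite /C3; move: rT; rewrite mulrAC mulrDr mulr1.
  lra.
  Unshelve. all: end_near.
have smallA : \forall r \near 0^'+, forall b : mindex n l, (0 < mdegree b)%N ->
    r ^+ mdegree b * ipnorm dV (al r b) <= C3 * T.
  apply: filter_forall => b.
  have [b0|b0] := ltnP 0 (mdegree b); first by apply: filterS (small b b0).
  exact: nearW.
near=> r; have rp : 0 < r by [].
have rr0 : r <= r0 by near: r; exact: nbhs_right_le.
have rC : forall b : mindex n l, (0 < mdegree b)%N ->
    r ^+ mdegree b * ipnorm dV (al r b) <= C3 * T.
  by near: r; exact: smallA.
have [rO rL] := good r rp rr0.
have C3T := mulr_gt0 C30 T0.
have cT := mulr_gt0 c0 T0.
have C2T := mulr_gt0 C20 (addr_gt0 C3T cT).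
split=> [b /andP[b0 bl]|].
  have := rC b b0; rewrite /al bl => h; apply: (le_trans h); lra.
apply: (@le_trans _ _ (C2 * ((C3 + c) * T))%:E); last by rewrite lee_fin; lra.
apply: (C2P x r _ u (al r)) => //.
- by rewrite mulrDl addr_gt0.
- by move=> v; exact: muO.
- apply: (le_trans rL); rewrite lee_fin ler_wpM2r ?exprn_ge0 ?(ltW rp)//; lra.
- by move=> b b0; apply: (le_trans (rC b b0)); lra.
Unshelve. all: end_near.
Qed.
End SmallRadii.

Theorem theorem3 (R : realType) (n : nat) (V W : vectType R)
    (dV : {dot V for idfun}) (dW : {dot W for idfun})
    (A : 'I_n -> 'Hom(V, W)) (l : nat) (c : R) :
  (2 <= n)%N -> complex_elliptic A -> (0 < l)%N -> 0 < c ->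
  exists2 C : R, 0 < C &
  forall (Omega : set 'rV[R]_n) (u : 'rV[R]_n -> V) (Au : vmeasure n dW)
    (p : 'rV[R]_n -> R -> 'rV[R]_n -> V)
    (a : 'rV[R]_n -> R -> mindex n l -> V),
  open Omega ->
  BV dV A Omega u Au ->
  (forall (x : 'rV[R]_n) (r : R), 0 < r -> eball x r `<=` Omega ->
    (forall y, p x r y =
      \sum_(b : mindex n l | (mdegree b <= l.-1)%N)
         monomial b (y - x) *: a x r b) /\
    (Lstar_norm dV (eball x r) (fun y => u y - p x r y)%R
      <= c%:E * vector_variation Au (eball x r))%E) ->
  (forall x, Omega x ->
    (forall b : mindex n l, (1 <= mdegree b <= l.-1)%N ->
      (limf_esup (fun r : R => (r ^+ mdegree b * ipnorm dV (a x r b))%:E) 0^'+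
        <= C%:E * upper_density Au x)%E) /\
    (limf_esup (mean_oscillation dV u x) 0^'+
      <= C%:E * upper_density Au x)%E) /\
  (forall x, (Omega `\` Theta Omega Au) x ->
    (forall b : mindex n l, (1 <= mdegree b <= l.-1)%N ->
      r ^+ mdegree b * ipnorm dV (a x r b) @[r --> 0^'+] --> (0 : R)) /\
    mean_oscillation dV u x r @[r --> 0^'+] --> (0%E : \bar R)).
Proof.
move=> n2 _ l0 c0; have [C C0 CP] := bounds_near_zero dV dW n2 l0 c0.
exists C => // Omega u Au p a oO [uL1 _] paP.
have {}CP := CP Omega u Au p a oO uL1 paP.
split=> x.
  move=> Ox; split=> [b bl|]; apply: limf_esup_le_scale => //;
    try exact: upper_density_ge0;
    move=> T T0 /(CP _ _ Ox T0); apply: filterS => r [ra rm] //.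
  by rewrite lee_fin ra.
move=> [Ox nTh].
have d0 T : 0 < T -> (upper_density Au x < T%:E)%E.
  move=> T0; apply: (@le_lt_trans _ _ 0%E); last by rewrite lte_fin.
  by rewrite leNgt; apply/negP => dx; apply: nTh.
split=> [b bl|].
  have h T : 0 < T ->
      \forall r \near 0^'+, r ^+ mdegree b * ipnorm dV (a x r b) <= C * T.
    move=> T0; have := CP x T Ox T0 (d0 T T0); apply: filterS => r [ra _].
    exact: ra.
  apply: (cvg0_of_bound _ C0) => //; near=> r.
  by rewrite mulr_ge0 ?ipnorm_ge0// exprn_ge0// ltW.
apply: (cvge0_of_bound _ C0) => [r|T T0]; first exact: mean_oscillation_ge0.
by have := CP x T Ox T0 (d0 T T0); apply: filterS => r [].
Unshelve. all: end_near.
Qed.
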